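(* Let $n \ge 1$ and let $L$ be a finite graded lattice of rank $n$, with minimum element $\hat{0}$, maximum element $\hat{1}$ and rank function $\rho$, and let $\bar{L} = L \setminus \{\hat{0}, \hat{1}\}$ be its proper part. Let $\Bbbk$ be a fixed field or $\mathbb{Z}$. If $\widetilde{H}_{n-2}(\Delta(\bar{L}); \Bbbk) \ne 0$, then $$ f_L(S) \ \ge\ \alpha_n(S) $$ for every $S \subseteq [n-1]$. In other words, the Boolean algebra $B_n$ of rank $n$ minimizes the flag $f$-vector among all finite graded lattices of rank $n$ whose proper part has nontrivial top-dimensional reduced homology over $\Bbbk$.
   Context: For a finite poset $Q$, $\Delta(Q)$ denotes its order complex, the simplicial complex of all chains of $Q$; $\widetilde{H}_*(\Delta;\Bbbk)$ denotes reduced simplicial homology with coefficients in $\Bbbk$. For a finite graded poset $P$ of rank $n$ with $\hat 0,\hat 1$ and rank function $\rho$, and $S \subseteq [n-1] = \{1,\dots,n-1\}$, $f_P(S)$ is the number of chains $\mathcal{C} \subseteq P \setminus \{\hat{0},\hat{1}\}$ with $\{\rho(x) : x \in \mathcal{C}\} = S$ (the flag $f$-vector of $P$). For $S = \{s_1 < \cdots < s_l\} \subseteq [n-1]$, $\alpha_n(S)$ is the multinomial coefficient $\binom{n}{s_1, s_2 - s_1, \dots, n - s_l}$, which equals $f_{B_n}(S)$, where $B_n$ is the lattice of subsets of $[n]$ ordered by inclusion. *)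

(* Defs.v *)
From HB Require Import structures.
From mathcomp Require Import all_boot all_order all_algebra.
From mathcomp Require Import ring_quotient.
From mathcomp Require Import boolp.

Set Implicit Arguments.
Unset Strict Implicit.
Unset Printing Implicit Defensive.

Import Order.TTheory GRing.Theory Num.Theory.

Local Open Scope ring_scope.

Section Posets.
Variables (d : Order.disp_t) (P : finTBPOrderType d).
Implicit Types (x y z : P) (C : {set P}).

Definition is_chain C : bool :=
  [forall x in C, forall y in C, (x >=< y)%O].

Definition covered_by x y : bool :=
  (x < y)%O && [forall z, ~~ (x < z < y)%O].

(* A chain of length n has n + 1 elements. *)
Definition graded_of_rank (n : nat) : Prop :=
  forall C, maxset is_chain C -> #|C| = n.+1.

Definition rank_function (rho : P -> nat) : Prop :=
  rho \bot%O = 0%N /\ forall x y, covered_by x y -> rho y = (rho x).+1.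

Definition proper_part : {set P} := [set x | x != \bot%O & x != \top%O].

(* The empty chain is included, as the face of dimension -1. *)
Definition order_complex (A : {set P}) : {set {set P}} :=
  [set C | is_chain C & C \subset A].

(* S is a set of natural numbers smaller than n; the two quantified conditions
   say that rho maps C onto S. *)
Definition flag_f (rho : P -> nat) (n : nat) (S : {set 'I_n}) : nat :=
  #|[set C : {set P} | [&& is_chain C, C \subset proper_part,
      [forall x in C, exists s in S, rho x == s]
    & [forall s in S, exists x in C, rho x == s]]]|.

End Posets.

Arguments graded_of_rank {d} P n.
Arguments proper_part {d} P.

Definition multinomial (ks : seq nat) : nat :=
  ((sumn ks)`! %/ \prod_(k <- ks) k`!)%N.

(* [enum S] lists S = {s_1 < ... < s_l} increasingly, so the arguments of the
   multinomial are s_1, s_2 - s_1, ..., n - s_l, and just n if S is empty. *)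
Definition alpha (n : nat) (S : {set 'I_n}) : nat :=
  multinomial
    (pairmap (fun a b => b - a)%N 0%N (rcons [seq val s | s <- enum S] n)).

Section Homology.
Variables (T : finType) (k : comNzRingType) (K : {set {set T}}).
Implicit Types (i j : int).

(* A face with m vertices has dimension m - 1; the empty face has dimension -1,
   which makes the homology below the reduced one. *)
Definition face i : Type := {F : {set T} | (F \in K) && (#|F|%:Z - 1 == i)}.

HB.instance Definition _ i := SubFinite.on (face i).

Definition chain_group i : Type := {ffun face i -> k}.

HB.instance Definition _ i := GRing.Zmodule.on (chain_group i).

(* The coefficient of G in the boundary of F, each face being oriented by the
   order in which T is enumerated: if F = {x_0, ..., x_m} in that order, it is
   (-1)^r if G = F \ {x_r}, and 0 if G is not a facet of F. *)
Definition incidence (F G : {set T}) : k :=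
  \sum_(x in F | F :\ x == G)
    (-1) ^+ #|[set y in F | (enum_rank y < enum_rank x)%N]|.

(* The intended use is j = i - 1. The target degree is a separate parameter
   because i + 1 - 1 and i are not convertible. *)
Definition boundary i j (c : chain_group i) : chain_group j :=
  [ffun G : face j => \sum_(F : face i) incidence (val F) (val G) * c F].

Lemma boundary_is_zmod_morphism i j : zmod_morphism (@boundary i j).
Proof.
move=> a b; apply/ffunP=> G; rewrite !ffunE -sumrB.
by apply: eq_bigr => F _; rewrite !ffunE mulrBr.
Qed.

HB.instance Definition _ i j :=
  GRing.isZmodMorphism.Build (chain_group i) (chain_group j) (@boundary i j)
    (@boundary_is_zmod_morphism i j).

Definition is_cycle i : {pred chain_group i} :=
  fun z => boundary (i - 1) z == 0.

Lemma is_cycle_zmod_closed i : zmod_closed (@is_cycle i).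
Proof.
split=> [|a b]; rewrite !unfold_in ?raddf0 //.
by rewrite raddfB /= => /eqP-> /eqP->; rewrite subr0.
Qed.

HB.instance Definition _ i :=
  GRing.isZmodClosed.Build (chain_group i) (@is_cycle i)
    (@is_cycle_zmod_closed i).

Record cycle_group i := Cycle {
  cycle_val :> chain_group i;
  _ : cycle_val \in @is_cycle i }.

HB.instance Definition _ i := [isSub for @cycle_val i].
HB.instance Definition _ i := [Choice of cycle_group i by <:].
HB.instance Definition _ i :=
  [SubChoice_isSubZmodule of cycle_group i by <:].

Definition is_boundary i : {pred cycle_group i} :=
  fun z => `[< exists c : chain_group (i + 1), boundary i c = val z >].

Lemma is_boundary_zmod_closed i : zmod_closed (@is_boundary i).
Proof.
split=> [|a b]; rewrite !unfold_in.
  by apply/asboolP; exists 0; rewrite !raddf0.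
move=> /asboolP[a' ea] /asboolP[b' eb]; apply/asboolP; exists (a' - b').
by rewrite !raddfB /= ea eb.
Qed.

HB.instance Definition _ i :=
  GRing.isZmodClosed.Build (cycle_group i) (@is_boundary i)
    (@is_boundary_zmod_closed i).

(* The underlying abelian group of the i-th reduced homology module. *)
Definition reduced_homology i : zmodType := Quotient.quot (@is_boundary i).

End Homology.

Arguments reduced_homology {T} k K i.

Variant field_or_Z : comNzRingType -> Prop :=
| is_field (F : fieldType) : field_or_Z F
| is_Z : field_or_Z int.

(* Main.v *)
(* A nonzero homology class is represented by a nonzero cycle. The facets in its
   support form a family of chains in which any element of a member can be
   exchanged for a different one of the same rank: otherwise the boundary would
   not vanish at the ridge left by deleting it. This property passes to links,
   hence to the parts of the family above or below a given element.

   Let a be an element of lowest rank in a member. The first element of a chain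
   to lie above a is the join of a with its predecessor, so it can only be
   exchanged for an element not above a; pushing these exchanges upwards gives
   an element c of highest rank that is not above a. No element lies both above
   a and below c, so Pascal's rule yields at least binomial(n, r) elements of
   rank r by induction. The multinomial bound follows by choosing the elements
   of a flag from the bottom up. *)

Require Import Defs.
From mathcomp Require Import all_boot all_order all_algebra.
From mathcomp Require Import zify.

Set Implicit Arguments.
Unset Strict Implicit.
Unset Printing Implicit Defensive.

Import Order.TTheory GRing.Theory Num.Theory.

Local Open Scope ring_scope.

Section Combinatorics.

Lemma multinomial_fact (ks : seq nat) :
  (multinomial ks * \prod_(k <- ks) k`! = (sumn ks)`!)%N.
Proof.
rewrite /multinomial divnK //.
elim: ks => [|k ks IHks]; first by rewrite big_nil.
rewrite big_cons /= -(bin_fact (leq_addr (sumn ks) k)) addKn.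
by rewrite dvdn_mull // dvdn_mul.
Qed.

Lemma multinomial_cons (k : nat) (ks : seq nat) :
  multinomial (k :: ks) = ('C(k + sumn ks, k) * multinomial ks)%N.
Proof.
have prod_gt0 : (0 < \prod_(j <- k :: ks) j`!)%N.
  by apply: prodn_gt0 => j; rewrite fact_gt0.
apply/eqP; rewrite -(eqn_pmul2r prod_gt0) multinomial_fact /= big_cons.
rewrite -(bin_fact (leq_addr (sumn ks) k)) addKn -(multinomial_fact ks).
by apply/eqP; lia.
Qed.

Lemma multinomial1 (k : nat) : multinomial [:: k] = 1%N.
Proof. by rewrite multinomial_cons addn0 binn /multinomial big_nil. Qed.

Lemma leq_path_last (a : nat) (l : seq nat) : path leq a l -> (a <= last a l)%N.
Proof. by elim: l a => //= b l IHl a /andP[/leq_trans ab /IHl /ab]. Qed.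

Lemma sumn_pairmap_subn (a : nat) (l : seq nat) :
  path leq a l -> sumn (pairmap (fun i j => j - i)%N a l) = (last a l - a)%N.
Proof.
elim: l a => [|b l IHl] a /=; first by rewrite subnn.
by case/andP=> ab bl; rewrite IHl // addnC addnBA // subnK // leq_path_last.
Qed.

Lemma sum_card_mem (T : finType) (A : {set T}) (F : {set {set T}}) :
  (\sum_(x in A) #|[set B in F | x \in B]| = \sum_(B in F) #|A :&: B|)%N.
Proof.
under eq_bigr do rewrite -sum1dep_card.
rewrite (exchange_big_dep [in F]) /= => [|x B _ /andP[]//].
apply: eq_bigr => B FB; rewrite -sum1_card.
by apply: eq_bigl => x; rewrite FB inE.
Qed.

Lemma ltn_sorted_enum_ord (n : nat) (S : {set 'I_n}) :
  sorted ltn [seq val s | s <- enum S].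
Proof.
apply: (subseq_sorted ltn_trans _ (iota_ltn_sorted 0 n)).
by rewrite -val_enum_ord map_subseq // (enumT 'I_n) filter_subseq.
Qed.

Lemma path_ltn_enum_ord (n : nat) (S : {set 'I_n}) :
    (0 < n)%N -> {in S, forall s : 'I_n, (0 < s)%N} ->
  path ltn 0 (rcons [seq val s | s <- enum S] n).
Proof.
move=> n_gt0 S_gt0; rewrite (path_sortedE ltn_trans) all_rcons /= n_gt0 /=.
rewrite !(sorted_pairwise ltn_trans) pairwise_rcons.
rewrite -(sorted_pairwise ltn_trans) ltn_sorted_enum_ord andbT.
apply/andP; split; apply/allP => _ /mapP[s sS ->]; last exact: ltn_ord.
by apply: S_gt0; rewrite -mem_enum.
Qed.

End Combinatorics.

Section Chains.
Variables (d : Order.disp_t) (P : finTBPOrderType d).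
Implicit Types (x y z : P) (C D : {set P}).

Lemma is_chainP C :
  reflect {in C &, forall x y, (x >=< y)%O} (is_chain C).
Proof.
apply: (iffP forall_inP) => [cC x y /cC/forall_inP|cC x xC]; first exact.
by apply/forall_inP => y; apply: cC.
Qed.

Lemma is_chain_set0 : @is_chain d P set0.
Proof. by apply/is_chainP => x; rewrite in_set0. Qed.

Lemma is_chain_set1 x : is_chain [set x].
Proof. by apply/is_chainP => y z /set1P-> /set1P->; exact: comparablexx. Qed.

Lemma is_chainS C D : C \subset D -> is_chain D -> is_chain C.
Proof.
move=> /subsetP CD /is_chainP cD; apply/is_chainP => x y /CD + /CD.
exact: cD.
Qed.

Lemma is_chain_setU1 x C :
  {in C, forall y, (x >=< y)%O} -> is_chain C -> is_chain (x |: C).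
Proof.
move=> cx /is_chainP cC; apply/is_chainP => y z.
case/setU1P=> [->|yC] /setU1P[->|zC]; first exact: comparablexx.
- exact: cx.
- by rewrite comparable_sym cx.
exact: cC.
Qed.

Lemma leq_card_filter_ideal (A : {set P}) x y : ~~ (x <= y)%O ->
  (#|[set z in A | x <= z]%O| + #|[set z in A | z <= y]%O| <= #|A|)%N.
Proof.
move=> nxy; rewrite -cardsUI [X in (_ + X)%N](_ : _ = 0)%N ?addn0; last first.
  apply: eq_card0 => z; rewrite !inE; apply: contraNF nxy.
  by move=> /andP[/andP[_ xz] /andP[_ /(le_trans xz)]].
by apply: subset_leq_card; rewrite subUset !setIdE !subsetIl.
Qed.

Lemma order_complex_setD1 (A : {set P}) :
  {in order_complex A, forall C x, C :\ x \in order_complex A}.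
Proof.
move=> C /setIdP[cC sC] x; rewrite inE (is_chainS (subsetDl _ _) cC).
exact: subset_trans (subsetDl _ _) sC.
Qed.

End Chains.

Section RankFunctions.
Variables (d : Order.disp_t) (P : finTBPOrderType d) (rho : P -> nat).
Hypothesis rho_rank : rank_function rho.
Implicit Types (x y z : P) (C : {set P}).

Lemma rank_function_lt : {homo rho : x y / (x < y)%O >-> (x < y)%N}.
Proof.
move=> x y; have [m] := ubnP #|[set z | (x < z < y)%O]|.
elim: m x y => // m IHm x y; rewrite ltnS => le_xy lt_xy.
have [/rho_rank.2-> //|] := boolP (covered_by x y).
rewrite /covered_by lt_xy => /forallPn[z /negPn/andP[xz zy]].
have shrink x' y' : (x <= x')%O -> (y' <= y)%O -> ~~ (x' < z < y')%O ->
    (#|[set w | (x' < w < y')%O]| < m)%N.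
  move=> xx' y'y nz; apply: leq_trans le_xy; apply: proper_card.
  apply/properP; split; last by exists z; rewrite !inE ?xz ?zy.
  apply/subsetP => w; rewrite !inE => /andP[x'w wy'].
  by rewrite (le_lt_trans xx' x'w) (lt_le_trans wy' y'y).
apply: (@ltn_trans (rho z)); apply: IHm => //; apply: shrink => //.
- exact: ltW.
- by rewrite ltxx andbF.
- exact: ltW.
by rewrite ltxx.
Qed.

Lemma rank_function_gt0 x : (0 < rho x)%N = (x != \bot%O).
Proof.
have [->|] := eqVneq x \bot%O; first by rewrite rho_rank.1.
by rewrite -lt0x => /rank_function_lt; rewrite rho_rank.1.
Qed.

Lemma exists_covered_by y : y != \bot%O -> exists x, covered_by x y.
Proof.
rewrite -lt0x => lt0y.
have [x xy max_x] := @arg_maxnP _ \bot%O (fun x => x < y)%O rho lt0y.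
exists x; rewrite /covered_by xy.
apply/forallP => z; apply/negP => /andP[xz zy].
by have := max_x z zy; rewrite /= leqNgt rank_function_lt.
Qed.

Lemma exists_chain_below y :
  exists C, [/\ is_chain C, #|C| = (rho y).+1 & {in C, forall x, (x <= y)%O}].
Proof.
elim: (rho y) {-2}y (erefl (rho y)) => {y} [|r IHr] y ry.
  exists [set y]; split; first exact: is_chain_set1.
    by rewrite cards1 ry.
  by move=> x /set1P->.
have [x cov_xy] : exists x, covered_by x y.
  by apply: exists_covered_by; rewrite -rank_function_gt0 ry.
have ryx : rho y = (rho x).+1 by apply: rho_rank.2.
have lt_xy : (x < y)%O by case/andP: cov_xy.
have [C [cC cardC leCx]] := IHr x (succn_inj (etrans (esym ryx) ry)).
have ltCy : {in C, forall z, (z < y)%O} by move=> z /leCx /le_lt_trans; apply.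
exists (y |: C); split.
- apply: is_chain_setU1 => // z /ltCy /ltW zy.
  by rewrite /Order.comparable zy orbT.
- suff ynC : y \notin C by rewrite cardsU1 ynC cardC -ryx.
  by apply/negP => /ltCy; rewrite ltxx.
by move=> z /setU1P[->//|/ltCy/ltW].
Qed.

End RankFunctions.

Section ExchangeFamilies.
Variables (d : Order.disp_t) (P : finTBPOrderType d) (rho : P -> nat).
Hypothesis rho_lt : {homo rho : x y / (x < y)%O >-> (x < y)%N}.
Implicit Types (x y z : P) (C D F : {set P}) (M : {set {set P}}).
Implicit Types (R A : {pred nat}) (l : seq nat).

Lemma comparable_leq_rank x y : (x >=< y)%O -> (rho x <= rho y)%N = (x <= y)%O.
Proof.
case/comparable_ltgtP => [/rho_lt/ltnW //|/rho_lt|->]; last exact: leqnn.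
by rewrite ltnNge => /negPf.
Qed.

Lemma le_rank_eq x y : (x <= y)%O -> (rho y <= rho x)%N -> x = y.
Proof.
by rewrite le_eqVlt => /predU1P[//|/rho_lt]; rewrite ltnNge => /negP.
Qed.

Lemma chain_rank_inj C : is_chain C -> {in C &, injective rho}.
Proof.
move=> /is_chainP cC x y xC yC rxy; apply: le_anti.
by rewrite -!comparable_leq_rank ?rxy ?leqnn // cC.
Qed.

Lemma chain_rank_lt C : is_chain C ->
  {in C &, {mono rho : x y / (x < y)%O >-> (x < y)%N}}.
Proof.
move=> /is_chainP cC x y xC yC.
have cxy := cC x y xC yC; rewrite comparable_ltNge // ltnNge.
by rewrite comparable_leq_rank // comparable_sym.
Qed.

Lemma uniq_chain_ranks C : is_chain C -> uniq [seq rho x | x in C].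
Proof. by move=> cC; apply/dinjectiveP; apply: chain_rank_inj. Qed.

Lemma chain_card_leq_size C l :
  is_chain C -> {in C, forall x, rho x \in l} -> (#|C| <= size l)%N.
Proof.
move=> cC rCl; rewrite -(size_image rho); apply: uniq_leq_size.
  exact: uniq_chain_ranks.
by move=> r /imageP[x xC ->]; apply: rCl.
Qed.

Lemma chain_ranks_eq C l :
    is_chain C -> {in C, forall x, rho x \in l} -> (size l <= #|C|)%N ->
  [seq rho x | x in C] =i l.
Proof.
move=> cC rCl; rewrite -(size_image rho C) => lC.
have [|_ //] := uniq_min_size (uniq_chain_ranks cC) _ lC.
by move=> r /imageP[x xC ->]; apply: rCl.
Qed.

Definition rank_part A C : {set P} := [set x in C | rho x \in A].

Definition rank_selection A M : {set {set P}} := [set rank_part A C | C in M].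

Definition level M (r : nat) : {set P} := [set x in cover M | rho x == r].

(* The facets of the link of the face [rank_part A C], in the complex with
   facets M. *)
Definition rank_link A M C : {set {set P}} :=
  rank_selection [predC A] [set D in M | rank_part A D == rank_part A C].

Definition link_above M C (r : nat) : {set {set P}} :=
  rank_link [pred i | i <= r]%N M C.

Definition link_below M C (r : nat) : {set {set P}} :=
  rank_link [pred i | r <= i]%N M C.

Definition flag_of_ranks R C : Prop :=
  is_chain C /\ [seq rho x | x in C] =i R.

(* The last clause says that the complex with facets M has no free ridge. *)
Definition exchange_family R M : Prop :=
  [/\ M != set0,
      {in M, forall C, flag_of_ranks R C}
    & {in M, forall C x, x \in C -> exists2 y, y != x & y |: C :\ x \in M}].

Lemma levelP M r x :
  reflect (rho x = r /\ exists2 C, C \in M & x \in C) (x \in level M r).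
Proof.
rewrite inE; apply: (iffP andP) => [[/bigcupP[C MC xC] /eqP rx]|[rx [C MC xC]]].
  by split=> //; exists C.
by split; [apply/bigcupP; exists C | apply/eqP].
Qed.

Lemma mem_level M C x : C \in M -> x \in C -> x \in level M (rho x).
Proof. by move=> MC xC; apply/levelP; split=> //; exists C. Qed.

Lemma exchange_family_chain R M C :
  exchange_family R M -> C \in M -> is_chain C.
Proof. by case=> _ flagM _ /flagM[]. Qed.

Lemma exchange_family_rank R M C x :
  exchange_family R M -> C \in M -> x \in C -> rho x \in R.
Proof. by case=> _ flagM _ /flagM[_ <-] xC; rewrite image_f. Qed.

Lemma exchange_family_exists R M C r :
  exchange_family R M -> C \in M -> r \in R -> exists2 x, x \in C & rho x = r.
Proof. by case=> _ flagM _ /flagM[_ <-] /imageP[x xC ->]; exists x. Qed.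

Lemma exchange_same_rank R M C x :
    exchange_family R M -> C \in M -> x \in C ->
  exists y, [/\ y != x, rho y = rho x & y |: C :\ x \in M].
Proof.
move=> exM MC xC; have [_ _ /(_ C MC x xC)[y yx MD]] := exM.
have cC := exchange_family_chain exM MC.
exists y; split=> //.
have [w /setU1P[-> //|/setD1P[wx wC]] rw] :=
  exchange_family_exists exM MD (exchange_family_rank exM MC xC).
by rewrite (chain_rank_inj cC wC xC rw) eqxx in wx.
Qed.

Lemma rank_linkP A M C D :
  reflect (exists E, [/\ E \in M, rank_part A E = rank_part A C
                       & D = rank_part [predC A] E])
          (D \in rank_link A M C).
Proof.
apply: (iffP imsetP) => [[E + ->]|[E [ME EC ->]]].
  by rewrite inE => /andP[ME /eqP EC]; exists E.
by exists E; rewrite // inE ME EC /=.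
Qed.

Lemma exchange_family_link R' R A M C :
    exchange_family R M -> C \in M -> R' =i [predD R & A] ->
  exchange_family R' (rank_link A M C).
Proof.
move=> exM MC R'E; split.
- by apply/set0Pn; exists (rank_part [predC A] C); apply/rank_linkP; exists C.
- move=> D /rank_linkP[E [ME _ ->]]; split.
    apply: is_chainS (exchange_family_chain exM ME).
    by apply/subsetP => x /setIdP[].
  move=> r; rewrite R'E; apply/imageP/andP => [[x + ->]|[rA rR]].
    rewrite !inE => /andP[xE xA]; split=> //.
    exact: exchange_family_rank ME xE.
  have [x xE rx] := exchange_family_exists exM ME rR.
  by exists x; rewrite // !inE xE rx.
move=> D /rank_linkP[E [ME EC ->]] x; rewrite !inE => /andP[xE xA].
have [y [yx ryx MF]] := exchange_same_rank exM ME xE.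
exists y => //; apply/rank_linkP; exists (y |: E :\ x); split=> //.
  rewrite -EC; apply/setP => z; rewrite !inE.
  have [->|_] := eqVneq z y; first by rewrite ryx (negPf xA) !andbF.
  by have [->|//] := eqVneq z x; rewrite (negPf xA) !andbF.
apply/setP => z; rewrite !inE.
by have [->|_] := eqVneq z y; rewrite ?ryx ?xA /= ?andbA.
Qed.

Definition ranks_between (p q : nat) : {pred nat} := [pred r | p < r < q]%N.

Lemma exchange_family_above p q r M C :
    exchange_family (ranks_between p q) M -> C \in M -> (p <= r)%N ->
  exchange_family (ranks_between r q) (link_above M C r).
Proof.
move=> exM MC pr; apply: exchange_family_link exM MC _ => i.
by rewrite !inE; lia.
Qed.

Lemma exchange_family_below p q r M C :
    exchange_family (ranks_between p q) M -> C \in M -> (r <= q)%N ->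
  exchange_family (ranks_between p r) (link_below M C r).
Proof.
move=> exM MC rq; apply: exchange_family_link exM MC _ => i.
by rewrite !inE; lia.
Qed.

Lemma level_rank_link A R M C x y r :
    exchange_family R M -> y \in C -> rho y \in A ->
  x \in level (rank_link A M C) r -> x \in level M r /\ (x >=< y)%O.
Proof.
move=> exM yC yA /levelP[<- [D /rank_linkP[E [ME EC ->]]]].
rewrite inE => /andP[xE _].
have /setIdP[yE _] : y \in rank_part A E by rewrite EC inE yC.
split; first exact: mem_level ME xE.
by have /is_chainP := exchange_family_chain exM ME; apply.
Qed.

Lemma level_above_subset R M C y r :
    exchange_family R M -> y \in C -> (rho y <= r)%N ->
  level (link_above M C (rho y)) r
    \subset [set x in level M r | (y <= x)%O].
Proof.
move=> exM yC yr; apply/subsetP => x xr; have /levelP[rx _] := xr.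
have [|xM cxy] := level_rank_link exM yC _ xr; first exact: leqnn.
by apply/setIdP; rewrite -comparable_leq_rank ?rx // comparable_sym.
Qed.

Lemma level_below_subset R M C y r :
    exchange_family R M -> y \in C -> (r <= rho y)%N ->
  level (link_below M C (rho y)) r
    \subset [set x in level M r | (x <= y)%O].
Proof.
move=> exM yC ry; apply/subsetP => x xr; have /levelP[rx _] := xr.
have [|xM cxy] := level_rank_link exM yC _ xr; first exact: leqnn.
by apply/setIdP; rewrite -comparable_leq_rank ?rx.
Qed.

Lemma leq_sum_rank_selection l r R M : exchange_family R M ->
  (\sum_(x in level M r) #|[set F in rank_selection [in r :: l] M | x \in F]|
    <= #|rank_selection [in r :: l] M|)%N.
Proof.
move=> exM; rewrite sum_card_mem -sum1_card; apply: leq_sum => F.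
case/imsetP=> C MC ->; apply/card_le1_eqP => x y.
case/setIP=> /levelP[rx _] /setIdP[xC _] /setIP[/levelP[ry _] /setIdP[yC _]].
by apply: (chain_rank_inj (exchange_family_chain exM MC)) => //; rewrite rx.
Qed.

Lemma rank_selection_link_above l M C x F :
    x \in C -> all (ltn (rho x)) l ->
    F \in rank_selection [in l] (link_above M C (rho x)) ->
  exists E, [/\ E \in M, x \in E & F = rank_part [in l] E].
Proof.
move=> xC /allP lt_xl /imsetP[D /rank_linkP[E [ME EC ->]] ->].
exists E; split=> //.
  have /setIdP[//] : x \in rank_part [pred i | i <= rho x]%N E.
  by rewrite EC !inE xC /=.
apply/setP => z; rewrite !inE -andbA; congr andb.
by apply: andb_idl => /lt_xl /=; rewrite -ltnNge.
Qed.

Lemma leq_rank_selection_link_above l R M C x :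
    exchange_family R M -> x \in C -> all (ltn (rho x)) l ->
  (#|rank_selection [in l] (link_above M C (rho x))|
    <= #|[set F in rank_selection [in rho x :: l] M | x \in F]|)%N.
Proof.
move=> exM xC lt_xl.
have selP F := @rank_selection_link_above l M C x F xC lt_xl.
have x_notin E : x \notin rank_part [in l] E.
  rewrite !inE negb_and; apply/orP; right.
  by apply/negP => /(allP lt_xl) /=; rewrite ltnn.
have injx : {in rank_selection [in l] (link_above M C (rho x)) &,
    injective (fun F => x |: F)}.
  move=> F G /selP[E1 [_ _ ->]] /selP[E2 [_ _ ->]] eqFG.
  by rewrite -(setU1K (x_notin E1)) eqFG setU1K.
rewrite -(card_in_imset injx); apply: subset_leq_card; apply/subsetP => G.
case/imsetP=> F /selP[E [ME xE ->]] ->; rewrite inE setU11 andbT.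
apply/imsetP; exists E => //; apply/setP => z; rewrite !inE.
have [->|zx] := eqVneq z x; first by rewrite xE eqxx.
have [zE|//] := boolP (z \in E); rewrite (_ : rho z == rho x = false) //.
have cE := exchange_family_chain exM ME.
by apply: contraNF zx => /eqP /(chain_rank_inj cE zE xE) ->.
Qed.

End ExchangeFamilies.

Section ExchangeFamiliesInLattices.
Variables (d : Order.disp_t) (L : finTBLatticeType d) (rho : L -> nat).
Hypothesis rho_lt : {homo rho : x y / (x < y)%O >-> (x < y)%N}.
Implicit Types (x y a : L) (C : {set L}) (M : {set {set L}}) (l : seq nat).
Local Notation exchange_family := (exchange_family rho).
Local Notation level := (level rho).

Lemma join_rank_succ w x a :
    (w < x)%O -> rho x = (rho w).+1 -> ~~ (a <= w)%O -> (a <= x)%O ->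
  (w `|` a)%O = x.
Proof.
move=> wx rx naw ax; apply: (le_rank_eq rho_lt); first by rewrite leUx ltW.
by rewrite rx; apply: rho_lt; rewrite lt_neqAle leUl eq_sym eq_joinl naw.
Qed.

Lemma level_notin_filter_exchange R M C x a :
    exchange_family R M -> C \in M -> x \in C ->
    (forall y, rho y = rho x -> y |: C :\ x \in M ->
       (a <= x)%O -> (a <= y)%O -> y = x) ->
  exists2 y, y \in level M (rho x) & ~~ (a <= y)%O.
Proof.
move=> exM MC xC eq_yx; have [ax|nax] := boolP (a <= x)%O; last first.
  by exists x; rewrite // (mem_level _ MC).
have [y [yx ryx MD]] := exchange_same_rank rho_lt exM MC xC.
exists y; last by apply: contraNN yx => ay; rewrite (eq_yx y).
by rewrite -ryx (mem_level _ MD) // setU11.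
Qed.

Lemma level_notin_filter_leq_rank R M r a :
    exchange_family R M -> r \in R -> (r <= rho a)%N ->
  exists2 x, x \in level M r & ~~ (a <= x)%O.
Proof.
move=> exM Rr ra; have [/set0Pn[C MC] _ _] := exM.
have [x xC rx] := exchange_family_exists exM MC Rr; rewrite -rx in ra *.
apply: (level_notin_filter_exchange exM MC xC) => y ryx _ ax ay.
by rewrite -(le_rank_eq rho_lt ay) ?ryx // (le_rank_eq rho_lt ax).
Qed.

(* In a chain that is not above a at w, an element x covering w and above a must
   be the join of w and a, so exchanging x yields an element not above a. *)
Lemma level_notin_filter_succ R M r a w :
    exchange_family R M -> r.+1 \in R -> w \in level M r -> ~~ (a <= w)%O ->
  exists2 x, x \in level M r.+1 & ~~ (a <= x)%O.
Proof.
move=> exM Rr /levelP[rw [C MC wC]] naw.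
have [x xC rx] := exchange_family_exists exM MC Rr; rewrite -rx.
apply: (level_notin_filter_exchange exM MC xC) => y ryx MD ax ay.
have lt_w D z : D \in M -> w \in D -> z \in D -> rho z = r.+1 -> (w < z)%O.
  move=> /(exchange_family_chain exM) cD wD zD rz.
  by rewrite -(chain_rank_lt rho_lt cD) // rz rw.
have wD : w \in y |: C :\ x.
  apply/setU1P; right; rewrite in_setD1 wC andbT.
  by apply: contra_eq_neq rx => <-; lia.
rewrite -(join_rank_succ _ _ naw ay) ?ryx ?rx ?rw //; last first.
  by apply: lt_w MD wD (setU11 _ _) _; rewrite ryx.
by apply: join_rank_succ => //; [exact: lt_w MC wC xC rx | rewrite rx rw].
Qed.

Lemma exists_level_notin_filter p q M a r :
    exchange_family (ranks_between p q) M -> (p < rho a)%N ->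
    r \in ranks_between p q ->
  exists2 x, x \in level M r & ~~ (a <= x)%O.
Proof.
move=> exM pa; elim: r => // r IHr Rr.
have [ra|ar] := leqP r.+1 (rho a).
  exact: (level_notin_filter_leq_rank exM).
have [|w wr naw] := IHr; first by move: Rr; rewrite !inE; lia.
exact: (level_notin_filter_succ exM Rr wr naw).
Qed.

(* Pascal's rule: no element lies both above a and below c, where a has the
   lowest rank, c has the highest rank and c is not above a. *)
Lemma leq_bin_level p m M r :
    exchange_family (ranks_between p (p + m)) M -> (0 < r < m)%N ->
  ('C(m, r) <= #|level M (p + r)|)%N.
Proof.
elim: m p M r => [|m IHm] p M [|r] exM //=; rewrite ltnS => rm.
have [/set0Pn[C MC] _ _] := exM.
have [a aC ra] : exists2 a, a \in C & rho a = p.+1.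
  by apply: (exchange_family_exists exM MC); rewrite inE; lia.
have [c /levelP[rc [D MD cD]] nac] :
    exists2 c, c \in level M (p + m) & ~~ (a <= c)%O.
  by apply: (exists_level_notin_filter exM); rewrite ?inE; lia.
have above : ('C(m, r) <= #|[set x in level M (p + r.+1) | a <= x]%O|)%N.
  case: r rm => [|r] rm.
    rewrite bin0; apply/card_gt0P; exists a; rewrite inE lexx andbT.
    by rewrite addn1 -ra (mem_level _ MC).
  apply: leq_trans (subset_leq_card
    (level_above_subset rho_lt exM aC _)); last lia.
  rewrite -(addSnnS p); apply: IHm => //; rewrite addSnnS -ra.
  by apply: (exchange_family_above rho_lt exM MC); rewrite ra.
have below : ('C(m, r.+1) <= #|[set x in level M (p + r.+1) | x <= c]%O|)%N.
  have [lt_rm|le_mr] := ltnP r.+1 m.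
    apply: leq_trans (subset_leq_card
      (level_below_subset rho_lt exM cD _)); last lia.
    apply: IHm => //; rewrite rc.
    by apply: (exchange_family_below rho_lt exM MD); rewrite leq_add2l.
  have -> : r.+1 = m by lia.
  rewrite binn; apply/card_gt0P; exists c; rewrite inE lexx andbT.
  by rewrite -rc (mem_level _ MD).
rewrite binS addnC; apply: leq_trans (leq_add above below) _.
exact: leq_card_filter_ideal.
Qed.

Lemma leq_multinomial_rank_selection p q M l :
    exchange_family (ranks_between p q) M -> path ltn p (rcons l q) ->
  (multinomial (pairmap (fun i j => j - i) p (rcons l q))
    <= #|rank_selection rho [in l] M|)%N.
Proof.
elim: l p M => [|r l IHl] p M exM.
  have [/set0Pn[C MC] _ _] := exM.
  move=> _; rewrite /= multinomial1; apply/card_gt0P.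
  by exists (rank_part rho [in [::]] C); apply: imset_f.
rewrite rcons_cons /= => /andP[pr rlq].
have /andP[lt_rl rq] : all (ltn r) l && (r < q)%N.
  by move: (order_path_min ltn_trans rlq); rewrite all_rcons andbC.
have le_rlq : path leq r (rcons l q) by apply: sub_path rlq => i j /ltnW.
rewrite multinomial_cons (sumn_pairmap_subn le_rlq) last_rcons.
apply: leq_trans (leq_sum_rank_selection rho_lt l r exM).
have -> : (r - p + (q - r) = q - p)%N by lia.
have le_bin : ('C(q - p, r - p) <= #|level M r|)%N.
  rewrite -[r in level M r](subnKC (ltnW pr)); apply: leq_bin_level; last lia.
  by rewrite subnKC //; lia.
apply: leq_trans (leq_mul le_bin (leqnn _)) _.
rewrite -sum_nat_const; apply: leq_sum => x /levelP[rx [C MC xC]].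
rewrite -rx in pr rlq lt_rl *.
apply: leq_trans (leq_rank_selection_link_above rho_lt exM xC lt_rl).
by apply: IHl rlq; apply: (exchange_family_above rho_lt exM MC); apply: ltnW.
Qed.

End ExchangeFamiliesInLattices.

Section GradedPosets.
Variables (d : Order.disp_t) (P : finTBPOrderType d) (rho : P -> nat) (n : nat).
Hypotheses (rho_rank : rank_function rho) (gradedP : graded_of_rank P n).
Implicit Types (x : P) (C : {set P}) (M : {set {set P}}).
Let rho_lt := rank_function_lt rho_rank.

Lemma graded_chain_card_leq C : is_chain C -> (#|C| <= n.+1)%N.
Proof. by move=> /maxset_exists[D /gradedP <-]; apply: subset_leq_card. Qed.

Lemma graded_rank_top : rho \top%O = n.
Proof.
apply/anti_leq/andP; split; rewrite -ltnS.
  have [C [cC <- _]] := exists_chain_below rho_rank \top%O.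
  exact: graded_chain_card_leq.
have [C maxC _] := maxset_exists (@is_chain_set0 d P).
rewrite -(gradedP maxC) -(size_iota 0 (rho \top%O).+1).
have [cC _] := maxsetP maxC; apply: (chain_card_leq_size rho_lt cC) => x xC.
by rewrite mem_iota ltnS comparable_leq_rank ?lex1 // /Order.comparable lex1.
Qed.

Lemma proper_part_rank x : x \in proper_part P -> rho x \in ranks_between 0 n.
Proof.
rewrite !inE -ltx1 => /andP[x0 /rho_lt]; rewrite graded_rank_top => ->.
by rewrite rank_function_gt0 // x0.
Qed.

Lemma facet_flag C :
    C \in order_complex (proper_part P) -> #|C| = n.-1 ->
  flag_of_ranks rho (ranks_between 0 n) C.
Proof.
move=> /setIdP[cC /subsetP sC] cardC; split=> // r.
have betweenE i : (i \in ranks_between 0 n) = (i \in iota 1 n.-1).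
  by rewrite mem_iota inE; lia.
rewrite betweenE; apply: chain_ranks_eq => //; last by rewrite size_iota cardC.
by move=> x /sC /proper_part_rank; rewrite betweenE.
Qed.

Lemma leq_rank_selection_flag_f (S : {set 'I_n}) R M :
    exchange_family rho R M -> M \subset order_complex (proper_part P) ->
    {in S, forall s : 'I_n, val s \in R} ->
  (#|rank_selection rho [in [seq val s | s <- enum S]] M| <= flag_f rho S)%N.
Proof.
move=> exM /subsetP sM SR; apply: subset_leq_card; apply/subsetP => F.
case/imsetP=> C MC ->; have /setIdP[cC sC] := sM C MC.
have sFC : rank_part rho [in [seq val s | s <- enum S]] C \subset C.
  by apply/subsetP => x /setIdP[].
rewrite inE (is_chainS sFC cC) (subset_trans sFC sC) /=; apply/andP; split.
  apply/forall_inP => x /setIdP[_ /mapP[s sS rx]].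
  by apply/exists_inP; exists s; [rewrite -mem_enum | rewrite rx].
apply/forall_inP => s sS.
have [x xC rx] := exchange_family_exists exM MC (SR s sS).
apply/exists_inP; exists x; last by rewrite rx.
by rewrite inE xC rx /= map_f // mem_enum.
Qed.

End GradedPosets.

Section CycleSupport.
Variables (T : finType) (k : comNzRingType) (K : {set {set T}}) (i : int).
Implicit Types (F G : {set T}) (x y : T) (z : chain_group k K i).

Lemma incidence_neq0 F G :
  incidence k F G != 0 -> exists2 x, x \in F & F :\ x = G.
Proof.
move=> nz; suff /exists_inP[x xF /eqP] : [exists x in F, F :\ x == G].
  by exists x.
apply: contraNT nz => /exists_inPn noF; rewrite /incidence big1 // => x.
by case/andP=> /noF/negPf->.
Qed.

Lemma incidence_setD1 F x : x \in F ->
  incidence k F (F :\ x) =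
    (-1) ^+ #|[set y in F | (enum_rank y < enum_rank x)%N]|.
Proof.
move=> xF; rewrite /incidence (bigD1 x) /=; last by rewrite xF eqxx.
rewrite big1 ?addr0 // => y /andP[/andP[yF /eqP/setP/(_ y) yP] yx].
by move: yP; rewrite !inE eqxx yF yx.
Qed.

Lemma card_face (F : face K i) : (#|val F|)%:Z = i + 1.
Proof. by have /andP[_ /eqP] := valP F; lia. Qed.

Definition chain_support z : {set {set T}} :=
  [set val F | F : face K i & z F != 0].

Lemma chain_supportP z F :
  reflect (exists2 F' : face K i, z F' != 0 & F = val F')
          (F \in chain_support z).
Proof.
by apply: (iffP imsetP) => -[F' zF' ->]; exists F'; rewrite // inE in zF' *.
Qed.

Lemma chain_support_neq0 z : z != 0 -> chain_support z != set0.
Proof.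
apply: contraNneq => supp0; apply/eqP/ffunP => F; rewrite ffunE; apply/eqP.
apply: contraT => zF; suff : val F \in chain_support z by rewrite supp0 inE.
by apply/chain_supportP; exists F.
Qed.

(* The boundary of z vanishes at the ridge F :\ x, to which F contributes, so
   that a second member of the support must contribute as well. *)
Lemma cycle_support_exchange z F x :
    {in K, forall G y, G :\ y \in K} ->
    z \in is_cycle (i := i) -> F \in chain_support z -> x \in F ->
  exists2 y, y != x & y |: F :\ x \in chain_support z.
Proof.
move=> K_down /eqP dz /chain_supportP[{}F zF ->] xF.
have faceG : (val F :\ x \in K) && (#|val F :\ x|%:Z - 1 == i - 1).
  have /andP[FK _] := valP F; rewrite K_down //=.
  by have := card_face F; rewrite (cardsD1 x (val F)) xF; move: #|_| => c; lia.
pose G : face K (i - 1) := Sub (val F :\ x) faceG.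
have [F' nF nz] : exists2 F' : face K i,
    F' != F & incidence k (val F') (val G) * z F' != 0.
  apply/exists_inP; apply: contraT => /exists_inPn others0.
  have /ffunP/(_ G) := dz; rewrite !ffunE (bigD1 F) //= big1 ?addr0; last first.
    by move=> F' /others0 /negPn/eqP.
  rewrite incidence_setD1 // => /(canRL (signrMK _)) zF0.
  by rewrite zF0 mulr0 eqxx in zF.
have [|y yF' eG] := @incidence_neq0 (val F') (val G).
  by apply: contraNneq nz => ->; rewrite mul0r.
exists y.
  apply: contraNneq nF => yx; apply/eqP/val_inj.
  by rewrite -(setD1K yF') eG -(setD1K xF) yx.
apply/chain_supportP; exists F'; last by rewrite -(setD1K yF') eG.
by apply: contraNneq nz => ->; rewrite mulr0.
Qed.

Lemma reduced_homology_neq0_cycle :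
  (exists h : reduced_homology k K i, h <> 0) ->
  exists2 z : chain_group k K i, z \in is_cycle (i := i) & z != 0.
Proof.
case; elim/quotW => z pi_z; exists (val z); first exact: valP.
apply: contra_notN pi_z => /eqP z0.
by rewrite (_ : z = 0) ?raddf0 //; apply: val_inj.
Qed.

End CycleSupport.

Lemma cycle_support_exchange_family (d : Order.disp_t) (P : finTBPOrderType d)
    (rho : P -> nat) (n : nat) (k : comNzRingType)
    (z : chain_group k (order_complex (proper_part P)) (n%:Z - 2)) :
    rank_function rho -> graded_of_rank P n ->
    z \in is_cycle (i := n%:Z - 2) -> z != 0 ->
  exchange_family rho (ranks_between 0 n) (chain_support z).
Proof.
move=> rho_rank gradedP z_cycle z_neq0; split; first exact: chain_support_neq0.
  move=> _ /chain_supportP[F _ ->].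
  apply: facet_flag => //; first by have /andP[] := valP F.
  by have := card_face F; move: #|_| => c; lia.
move=> F zF x xF; apply: cycle_support_exchange => //.
exact: order_complex_setD1.
Qed.

Theorem theorem1p1 (n : nat) (d : Order.disp_t) (L : finTBLatticeType d)
    (rho : L -> nat) (k : comNzRingType)
    (hn : (1 <= n)%N)
    (hL : graded_of_rank L n)
    (hrho : rank_function rho)
    (hk : field_or_Z k)
    (hH : exists h : reduced_homology k (order_complex (proper_part L)) (n%:Z - 2),
        h <> 0)
    (S : {set 'I_n}) (hS : forall s, s \in S -> (1 <= s)%N) :
  (alpha S <= flag_f rho S)%N.
Proof.
have [z z_cycle z_neq0] := reduced_homology_neq0_cycle hH.
have exz := cycle_support_exchange_family hrho hL z_cycle z_neq0.
have pathS := path_ltn_enum_ord hn hS.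
have rho_lt := rank_function_lt hrho.
apply: leq_trans (leq_multinomial_rank_selection rho_lt exz pathS) _.
apply: leq_rank_selection_flag_f exz _ _.
  by apply/subsetP => _ /chain_supportP[F _ ->]; have /andP[] := valP F.
by move=> s sS; rewrite inE hS //=.
Qed.
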